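(* Let $X$ be a non-empty set and let $d$ be a distance on $X$ that is simultaneously complete and an $H$-distance. Suppose there exist two numbers $\delta > 0$ and $a \geq 1$ such that, for all $x,y,z\in X$, if $d(x, y) \leq \delta$ and $d(y, z) \leq \delta$ then $d(x, z) \leq a\,[d(x,y) + d(y, z)]$. Let $\varphi : X \to X$ be a contraction. Then: 1. $\varphi$ is continuous (with respect to $\mathcal T(d)$) and has a unique fixed point. 2. Any periodic point of $\varphi$ is a fixed point of $\varphi$. 3. For every $x\in X$, the Picard orbit $(\varphi^n(x))_{n\in\mathbb N}$ is a Cauchy sequence convergent to the fixed point of $\varphi$.
   Context: $\mathbb N=\{1,2,\dots\}$. A distance on a non-empty set $X$ is a map $d:X\times X\to\mathbb R$ with $d(x,y)\ge 0$ for all $x,y$, and $d(x,y)+d(y,x)=0$ if and only if $x=y$ (no symmetry or triangle inequality is assumed). $B(x,d,r)=\{y\in X: d(x,y)<r\}$. A set $U\subseteq X$ is $d$-open if for each $x\in U$ there is $r>0$ with $B(x,d,r)\subseteq U$; $\mathcal T(d)$ is the topology of all $d$-open sets, and continuity refers to it. A distance $d$ is an $H$-distance if for any two distinct points $x,y\in X$ there is $\delta'>0$ such that $d(x,z)+d(y,z)\ge\delta'$ for every $z\in X$. A sequence $(x_n)$ converges to $x$ if $\lim_{n\to\infty}d(x,x_n)=0$; it is Cauchy if $\lim_{n,m\to\infty}d(x_n,x_m)=0$. The distance $d$ is complete if every Cauchy sequence converges to some point of $X$. $\varphi^n$ is the $n$-th iterate of $\varphi$. $\varphi$ is a contraction if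 there is $\lambda$ with $0\le\lambda<1$ such that $d(\varphi(x),\varphi(y))\le\lambda\, d(x,y)$ for all $x,y\in X$. A periodic point of $\varphi$ is a point $x$ with $\varphi^m(x)=x$ for some $m\ge1$. *)

(* Defs.v *)
From HB Require Import structures.
From mathcomp Require Import all_boot all_order all_algebra.
From mathcomp Require Import all_classical all_reals all_analysis.
Import Order.TTheory GRing.Theory Num.Theory.
Import numFieldNormedType.Exports.
Set Implicit Arguments.
Unset Strict Implicit.
Unset Printing Implicit Defensive.
Local Open Scope classical_set_scope.
Local Open Scope ring_scope.

Section Distance.
Context {R : realType} {X : Type}.
Implicit Types (d : X -> X -> R) (u : nat -> X) (phi : X -> X).

(* Neither symmetry nor the triangle inequality is required. *)
Definition is_distance d : Prop :=
  (forall x y, 0 <= d x y) /\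
  (forall x y, d x y + d y x = 0 <-> x = y).

Definition dball d (x : X) (r : R) : set X := [set y | d x y < r].

Definition dopen d (U : set X) : Prop :=
  forall x, U x -> exists2 r, 0 < r & dball d x r `<=` U.

Definition H_distance d : Prop :=
  forall x y, x <> y ->
    exists2 delta, 0 < delta & forall z, delta <= d x z + d y z.

(* The limit point is the first argument of d. This is convergence in the
   sense of d itself, not a priori convergence for the topology of d-open
   sets, as d-balls need not be neighbourhoods. *)
Definition dconverges d u (x : X) : Prop := d x (u n) @[n --> \oo] --> 0.

(* The two indices tend to infinity independently: since d is not symmetric,
   both orders of the indices matter. *)
Definition dcauchy d u : Prop :=
  d (u nm.1) (u nm.2) @[nm --> (\oo, \oo)] --> 0.

Definition dcomplete d : Prop :=
  forall u, dcauchy d u -> exists x, dconverges d u x.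

Definition dcontraction d phi : Prop :=
  exists2 lambda : R, 0 <= lambda < 1 &
    forall x y, d (phi x) (phi y) <= lambda * d x y.

Definition periodic_point phi (x : X) : Prop :=
  exists2 m, (1 <= m)%N & iter m phi x = x.

(* Sequences are indexed from 0 here, so the n-th term is the (n+1)-st
   iterate: the orbit starts at phi x. *)
Definition picard_orbit phi (x : X) : nat -> X := fun n => iter n.+1 phi x.

End Distance.

(* A copy of X carrying the topology of d-open sets. *)
Definition distance_space {R : realType} {X : Type} (d : X -> X -> R) : Type := X.

Section DistanceTopology.
Context {R : realType} {X : Type} (d : X -> X -> R).

HB.instance Definition _ := gen_eqMixin (distance_space d).
HB.instance Definition _ := gen_choiceMixin (distance_space d).

Let dopenT : dopen d setT.
Proof. by move=> x _; exists 1. Qed.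

Let dopenI : setI_closed (dopen d).
Proof.
move=> U V oU oV x [/oU[r r0 rU] /oV[s s0 sV]].
exists (Num.min r s); first by rewrite lt_min r0.
by move=> y; rewrite /dball /= lt_min => /andP[yr ys]; split; [exact: rU|exact: sV].
Qed.

Let dopen_bigU (I : Type) (f : I -> set X) :
  (forall i, dopen d (f i)) -> dopen d (\bigcup_i f i).
Proof.
move=> of_ x [i _ /of_[r r0 rf]]; exists r => // y /rf fy.
by exists i.
Qed.

HB.instance Definition _ :=
  @isOpenTopological.Build (distance_space d) (dopen d) dopenT dopenI dopen_bigU.

Lemma open_distance_spaceE (U : set (distance_space d)) : open U = dopen d U.
Proof. by []. Qed.

End DistanceTopology.

(* Main.v *)
Require Import Defs.
From HB Require Import structures.
From mathcomp Require Import all_boot all_order all_algebra.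
From mathcomp Require Import all_classical all_reals all_analysis.
From mathcomp Require Import ring lra.
Import Order.TTheory GRing.Theory Num.Theory.
Import numFieldNormedType.Exports.
Local Open Scope classical_set_scope.
Local Open Scope ring_scope.
Set Implicit Arguments.
Unset Strict Implicit.
Unset Printing Implicit Defensive.

(** Contractivity alone gives continuity, uniqueness of the fixed point, the
    statement on periodic points, and convergence of every orbit to a given
    fixed point [p], since [d p (phi^n x) = d (phi^n p) (phi^n x)] is at most
    [lambda ^ n * d p x].  What is left is that a fixed point exists.

    For this an orbit [x_n] is shown to be Cauchy.  Chaining consecutive terms
    with the relaxed triangle inequality is not enough: every application costs
    a factor [a], which [lambda] may be too large to absorb, and requires
    distances below [delta].  Instead, take [k] with [2 a lambda^k <= 1].  If the
    first [k] steps from [x_N] are tiny, then the whole tail stays within [eps]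
    of [x_N]: the tail from [x_(N+k)] on is the image by [phi^k] of the tail
    from [x_N], so it lies within [lambda^k * eps] of [x_(N+k)], and a single
    use of the relaxed inequality returns to
    [a * lambda^k * eps + eps / 2 <= eps] ([orbit_forward_small]).  This argument
    is invariant under exchanging the arguments of [d], which yields the other
    order of indices.

    By completeness the orbit has a limit [p].  Both [d p x_n] and
    [d (phi p) x_n] tend to [0], and the H-condition says exactly that two
    distinct points cannot both be limits of one sequence; so [phi p = p]. *)

Section Contraction.
Context {R : realType} {X : Type}.
Implicit Types (d : X -> X -> R) (phi : X -> X) (u : nat -> X).

Lemma is_distance_eq d x y :
  is_distance d -> d x y <= 0 -> d y x <= 0 -> x = y.
Proof.
move=> [d_ge0 d_eq0] dxy dyx; apply/d_eq0.
by rewrite (@le_anti _ _ (d x y) 0) ?dxy ?d_ge0// (@le_anti _ _ (d y x) 0)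
  ?dyx ?d_ge0// addr0.
Qed.

Lemma contraction_iter d phi (lambda : R) n x y : 0 <= lambda ->
  (forall x y, d (phi x) (phi y) <= lambda * d x y) ->
  d (iter n phi x) (iter n phi y) <= lambda ^+ n * d x y.
Proof.
move=> lambda_ge0 phi_lambda; elim: n => [|n IHn]; first by rewrite expr0 mul1r.
by rewrite !iterS (le_trans (phi_lambda _ _))// exprS -mulrA ler_wpM2l.
Qed.

Lemma geometric_le (lambda c eps : R) : 0 <= lambda < 1 -> 0 <= c -> 0 < eps ->
  exists N, forall n, (N <= n)%N -> lambda ^+ n * c <= eps.
Proof.
move=> /andP[lambda_ge0 lambda_lt1] c_ge0 eps_gt0.
have : lambda ^+ n * c @[n --> \oo] --> 0.
  rewrite -[X in _ --> X](mul0r c); apply: cvgM; last exact: cvg_cst.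
  by apply: cvg_expr; rewrite ger0_norm.
move=> /cvgrPdist_le /(_ _ eps_gt0) [N _ small]; exists N => n Nn.
by have /= := small n Nn; rewrite sub0r normrN ger0_norm// mulr_ge0// exprn_ge0.
Qed.

Lemma contraction_continuous d phi : is_distance d -> dcontraction d phi ->
  continuous (phi : distance_space d -> distance_space d).
Proof.
move=> [d_ge0 _] [lambda /andP[_ lambda_lt1] phi_lambda].
apply/continuousP => U; rewrite !open_distance_spaceE => oU x /oU[r r_gt0 rU].
exists r => // y dxy; apply: rU; apply: le_lt_trans dxy.
by rewrite (le_trans (phi_lambda _ _))// ler_piMl// ltW.
Qed.

(** If [x] has period [m], then so does [phi x], and the distances between the
    two in either order do not exceed [lambda ^ m] times themselves. *)
Lemma contraction_periodic d phi x : is_distance d -> dcontraction d phi ->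
  periodic_point phi x -> phi x = x.
Proof.
move=> dd [lambda /andP[lambda_ge0 lambda_lt1] phi_lambda] [m m_gt0 mx].
have d_ge0 := dd.1.
have mphix : iter m phi (phi x) = phi x by rewrite -iterSr iterS mx.
have self_le y z : iter m phi y = y -> iter m phi z = z -> d y z <= 0.
  move=> my mz; have := contraction_iter m y z lambda_ge0 phi_lambda.
  rewrite my mz => le_self; rewrite leNgt; apply/negP => dyz_gt0.
  move: le_self; rewrite ler_pMl// leNgt => /negP; apply.
  by rewrite exprn_ilt1 -?lt0n.
by apply: (is_distance_eq dd); exact: self_le.
Qed.

Lemma contraction_fixed_unique d phi x y : is_distance d ->
  dcontraction d phi -> phi x = x -> phi y = y -> x = y.
Proof.
move=> dd [lambda /andP[_ lambda_lt1] phi_lambda] fx fy.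
have fixed_le z t : phi z = z -> phi t = t -> d z t <= 0.
  move=> fz ft; have := phi_lambda z t; rewrite fz ft => le_self.
  rewrite leNgt; apply/negP => dzt_gt0; move: le_self.
  by rewrite ler_pMl// leNgt lambda_lt1.
by apply: (is_distance_eq dd); exact: fixed_le.
Qed.

(** The tail of the orbit from [x_N] stays near [x_N] by self-similarity: it is
    mapped by [phi^k] onto the tail from [x_(N+k)], which gives an induction on
    the number of steps by strides of [k]. *)
Lemma orbit_forward_small d phi (lambda delta a eps : R) x :
  (forall x y, 0 <= d x y) -> 0 < delta -> 1 <= a ->
  (forall x y z, d x y <= delta -> d y z <= delta ->
     d x z <= a * (d x y + d y z)) ->
  0 <= lambda < 1 -> (forall x y, d (phi x) (phi y) <= lambda * d x y) ->
  0 < eps ->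
  exists N, forall n m, (N <= n)%N -> (n <= m)%N ->
    d (iter n phi x) (iter m phi x) <= eps.
Proof.
move=> d_ge0 delta_gt0 a_ge1 d_relaxed lambda01 phi_lambda.
have /andP[lambda_ge0 lambda_lt1] := lambda01.
have a_gt0 : 0 < a by apply: lt_le_trans a_ge1.
(* The relaxed inequality is then available at distances up to [eps]. *)
wlog eps_delta : eps / eps <= delta => [small eps_gt0|eps_gt0].
  have min_gt0 : 0 < Num.min eps delta by rewrite lt_min eps_gt0.
  have [||N smallN] := small (Num.min eps delta) => //.
    by rewrite ge_min lexx orbT.
  by exists N => n m Nn nm; rewrite (le_trans (smallN _ _ Nn nm))// ge_min lexx.
have [k0 k0P] : exists N, forall n, (N <= n)%N -> lambda ^+ n * a <= 2^-1.
  by apply: geometric_le; rewrite ?invr_gt0// ltW.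
(* [k] has to be positive for the strides to decrease the number of steps. *)
set k := k0.+1; have {k0P} k_half : lambda ^+ k * a <= 2^-1 by exact: k0P.
have lambdak_le1 : lambda ^+ k <= 1 by rewrite exprn_ile1// ltW.
pose eta := eps / (2 * a).
have eta_gt0 : 0 < eta by rewrite divr_gt0// mulr_gt0.
have a_eta : a * eta = eps / 2 by rewrite /eta; field; rewrite gt_eqF.
have eta_eps : eta <= eps.
  by rewrite /eta ler_pdivrMr ?mulr_gt0// ler_peMr ?(ltW eps_gt0)//; lra.
pose M := \sum_(j < k.+1) d x (iter j phi x).
have [N NP] : exists N, forall n, (N <= n)%N -> lambda ^+ n * M <= eta.
  by apply: geometric_le => //; apply: sumr_ge0.
have shift_le n i j : d (iter (n + i) phi x) (iter (n + j) phi x) <=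
    lambda ^+ n * d (iter i phi x) (iter j phi x).
  by rewrite !iterD; exact: contraction_iter.
have first_steps j : (j <= k)%N -> d (iter N phi x) (iter (N + j) phi x) <= eta.
  move=> jk; apply: le_trans (NP N (leqnn N)).
  rewrite -{1}[N]addn0 (le_trans (shift_le _ _ _))// ler_wpM2l ?exprn_ge0//.
  rewrite /M (bigD1 (Ordinal (jk : (j < k.+1)%N)))//= lerDl.
  by apply: sumr_ge0.
have tail m : d (iter N phi x) (iter (N + m) phi x) <= eps.
  elim/ltn_ind: m => m IHm; have [mk|km] := leqP m k.
    by rewrite (le_trans (first_steps _ mk)).
  have stepk : d (iter N phi x) (iter (N + k) phi x) <= eta.
    exact: first_steps.
  have restk : d (iter (N + k) phi x) (iter (N + m) phi x) <= lambda ^+ k * eps.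
    have -> : (N + m = k + (N + (m - k)))%N by rewrite addnCA subnKC// ltnW.
    rewrite [(N + k)%N]addnC (le_trans (shift_le _ _ _))//.
    by rewrite ler_wpM2l ?exprn_ge0// IHm// ltn_subrL (leq_ltn_trans _ km).
  have restk_eps := le_trans restk (ler_piMl (ltW eps_gt0) lambdak_le1).
  apply: (le_trans (d_relaxed _ (iter (N + k) phi x) _ _ _)); try lra.
  have a_rest : a * (lambda ^+ k * eps) <= 2^-1 * eps.
    by rewrite mulrA [a * _]mulrC ler_wpM2r// ltW.
  by rewrite (le_trans (ler_wpM2l (ltW a_gt0) (lerD stepk restk)))//; lra.
exists N => n m Nn nm.
rewrite -(subnK Nn) -(subnKC nm) -{2}(subnK Nn) -addnA.
rewrite (le_trans (shift_le _ _ _))// (le_trans _ (tail (m - n)%N))//.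
by rewrite ler_piMl// exprn_ile1// ltW.
Qed.

Lemma contraction_orbit_cauchy d phi (delta a : R) x : is_distance d ->
  0 < delta -> 1 <= a ->
  (forall x y z, d x y <= delta -> d y z <= delta ->
     d x z <= a * (d x y + d y z)) ->
  dcontraction d phi -> dcauchy d (picard_orbit phi x).
Proof.
move=> [d_ge0 _] delta_gt0 a_ge1 d_relaxed [lambda lambda01 phi_lambda].
apply/cvgrPdist_le => eps eps_gt0.
have [N1 forward] := orbit_forward_small x d_ge0 delta_gt0 a_ge1 d_relaxed
  lambda01 phi_lambda eps_gt0.
have [N2 backward] : exists N, forall n m, (N <= n)%N -> (n <= m)%N ->
    d (iter m phi x) (iter n phi x) <= eps.
  apply: (@orbit_forward_small (fun y z => d z y) phi lambda delta a) => //.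
  by move=> y z t zy tz; rewrite addrC; exact: d_relaxed.
exists ([set n | (maxn N1 N2 <= n)%N], [set n | (maxn N1 N2 <= n)%N]) => /=.
  by split; exists (maxn N1 N2).
move=> [n m] /= [] ; rewrite !geq_max => /andP[N1n N2n] /andP[N1m N2m].
rewrite sub0r normrN ger0_norm//.
have [nm|/ltnW mn] := leqP n m.
  by apply: forward; rewrite ?ltnS// ltnW.
by apply: backward; rewrite ?ltnS// ltnW.
Qed.

Lemma contraction_orbit_converges d phi x p : is_distance d ->
  dcontraction d phi -> phi p = p -> dconverges d (picard_orbit phi x) p.
Proof.
move=> [d_ge0 _] [lambda lambda01 phi_lambda] fp.
have /andP[lambda_ge0 _] := lambda01.
apply/cvgrPdist_le => eps eps_gt0.
have [N small] := geometric_le lambda01 (d_ge0 p x) eps_gt0.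
exists N => // n Nn /=; rewrite sub0r normrN ger0_norm//.
apply: (le_trans _ (small n.+1 (leqW Nn))).
by rewrite -{1}[p](iter_fix n.+1 fp); exact: contraction_iter.
Qed.

Lemma H_distance_limit_unique d u x y : H_distance d ->
  dconverges d u x -> dconverges d u y -> x = y.
Proof.
move=> dH ux uy; apply: contrapT => /dH[r r_gt0 r_le].
have : d x (u n) + d y (u n) @[n --> \oo] --> 0.
  by rewrite -[X in _ --> X](addr0 0); exact: cvgD.
move=> /cvgrPdist_lt /(_ _ r_gt0) [N _ /(_ N (leqnn N))] /=.
by rewrite sub0r normrN ltNge (le_trans (r_le (u N)))// ler_norm.
Qed.

Lemma orbit_limit_fixed d phi x p : is_distance d -> H_distance d ->
  dcontraction d phi -> dconverges d (picard_orbit phi x) p -> phi p = p.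
Proof.
move=> [d_ge0 _] dH [lambda /andP[_ lambda_lt1] phi_lambda] orbit_p.
(* [phi p] is a limit of the image of the orbit, which is the shifted orbit. *)
pose u n := picard_orbit phi x n.+1.
have u_p : dconverges d u p by move: orbit_p; rewrite /dconverges -cvg_shiftS.
apply: (@H_distance_limit_unique d u) => //.
apply: (squeeze_cvgr _ (cvg_cst 0) orbit_p); apply: nearW => n.
by rewrite d_ge0/= /u (le_trans (phi_lambda _ _))// ler_piMl// ltW.
Qed.

End Contraction.

Theorem theorem2p6 (R : realType) (X : Type) (X_nonempty : [set: X] !=set0)
    (d : X -> X -> R) (d_distance : is_distance d)
    (d_complete : dcomplete d) (d_H : H_distance d)
    (delta a : R) (delta_gt0 : 0 < delta) (a_ge1 : 1 <= a)
    (d_relaxed : forall x y z : X, d x y <= delta -> d y z <= delta ->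
       d x z <= a * (d x y + d y z))
    (phi : X -> X) (phi_contraction : dcontraction d phi) :
  [/\ continuous (phi : distance_space d -> distance_space d) /\
        (exists! p : X, phi p = p),
      forall x : X, periodic_point phi x -> phi x = x
    & forall x : X, dcauchy d (picard_orbit phi x) /\
        (forall p : X, phi p = p -> dconverges d (picard_orbit phi x) p)].
Proof.
split; last 1 first.
- move=> x; split; first exact: (contraction_orbit_cauchy x
    d_distance delta_gt0 a_ge1 d_relaxed phi_contraction).
  by move=> p; exact: contraction_orbit_converges.
- split; first exact: contraction_continuous.
  have [x0 _] := X_nonempty.
  have [p orbit_p] := d_complete _ (contraction_orbit_cauchy x0 d_distance
    delta_gt0 a_ge1 d_relaxed phi_contraction).
  have fp := orbit_limit_fixed d_distance d_H phi_contraction orbit_p.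
  by exists p; split => // q; exact: (contraction_fixed_unique
    d_distance phi_contraction fp).
- by move=> x; exact: (contraction_periodic d_distance phi_contraction).
Qed.
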